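(* (Schwartz inequality) If $f$, $g \in L^2$, then $fg$ is integrable. Moreover $$\Bigl( \int_G |f(t)g(t)|\, d\mu(t) \Bigr)^2 \leq \Bigl( \int_G (f(t))^2\, d\mu(t) \Bigr) \Bigl( \int_G (g(t))^2\, d\mu(t) \Bigr),$$ $$\sqrt{\Bigl\| \Bigl( \int_G |f(t)g(t)|\, d\mu(t) \Bigr)^2 \Bigr\|_e } \leq \| f\|_2\, \| g \|_2 .$$
   Context: Setting. $X$ is a Dedekind complete vector lattice with an order unit $e$ (for every $x\in X$ there is a real $c>0$ with $|x|\le c e$). By the Maeda-Ogasawara-Vulikh theorem $X$ is lattice isomorphic to $C(\Omega)$, $\Omega$ compact and extremely disconnected, with $e$ corresponding to the constant function $1$; $X$ carries the corresponding pointwise multiplication, so it is a commutative $f$-algebra with unit $e$. $X^+$ denotes the set of elements $x\ge 0$, $x\neq 0$, and $\mathbb{R}^+=]0,+\infty[$. An $(o)$-sequence (in $X$ or $\mathbb{R}$) is a decreasing sequence with infimum $0$. $G$ is an infinite set, $\mathcal{A}$ an algebra of subsets of $G$, $\mu:\mathcal{A}\to[0,+\infty]$ a finitely additive measure, and $\mathcal{A}_b=\{B\in\mathcal{A}:\mu(B)<+\infty\}$. $\mathcal{F}$ is a fixed free filter of $\mathbb{N}$, i.e. a filter of subsets of $\mathbb{N}$ (not containing $\emptyset$) containing all cofinite sets. $(o_{\mathcal F})\lim_n x_n=x$ in $X$ means that there is an $(o)$-sequence $(\sigma_p)_p$ in $X$ with $\{n:|x_n-x|\le\sigma_p\}\in\mathcal{F}$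 for every $p$. A function $f:G\to X$ is simple iff it has finite range and $f^{-1}(\{x\})\in\mathcal{A}$ for every $x\in X$. $L^*$ is the set of simple functions vanishing outside a set of finite measure; for $f=\sum_i c_i 1_{E_i}\in L^*$ (with the $E_i\in\mathcal{A}_b$ pairwise disjoint), $\int_G f\,d\mu=\sum_i c_i\mu(E_i)$ and $\int_A f\,d\mu=\int_G f1_A\,d\mu$ for $A\in\mathcal{A}$. Put $\iota(f)=\int_G|f|\,d\mu$ for $f\in L^*$. A sequence $(f_n)_n$ in $X^G$ $\mu$-converges to $f\in X^G$ iff there are $(o)$-sequences $(\varepsilon_p)_p$, $(\sigma_p)_p$ in $\mathbb{R}^+$ and sets $A_n^p\in\mathcal{A}$ with $A_n^p\supset\{t\in G:|f_n(t)-f(t)|\not\le\varepsilon_p e\}$ for all $n,p$ and $\{n:\mu(A_n^p)\le\sigma_p\}\in\mathcal{F}$ for all $p$. A sequence $(f_n)_n$ in $L^*$ is equi-absolutely continuous iff there is a real $\alpha>0$ such that: (1) for every $(o)$-sequence $(\sigma_p)_p$ in $\mathbb{R}^+$ there are an $(o)$-sequence $(w_p)_p$ in $X^+$ and sets $\Lambda^p\in\mathcal{F}$ with $\iota(\alpha f_n1_B)\le w_p$ whenever $n\in\Lambda^p$, $B\in\mathcal{A}$, $\mu(B)\le\sigma_p$; (2) there are an $(o)$-sequence $(r_m)_m$ in $X^+$ and sets $B_m\in\mathcal{A}_b$ with $\{n:\iota(\alpha f_n1_{G\setminus B_m})\le r_m\}\in\mathcal{F}$ for every $m$. A positive $f:G\to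 X$ is integrable iff there are an equi-absolutely continuous sequence $(f_n)_n$ in $L^*$, $\mu$-convergent to $f$, and a map $l:\mathcal{A}\to X$ with $(o_{\mathcal F})\lim_n\bigvee_{A\in\mathcal{A}}|\int_A f_n\,d\mu-l(A)|=0$; such $(f_n)_n$ is called a defining sequence for $f$, and $\int_A f\,d\mu:=l(A)$ (independent of the defining sequence). A general $f:G\to X$ is integrable iff $f\vee0$ and $(-f)\vee0$ are, and its integral is the difference of the two integrals; a defining sequence for a general $f$ is a sequence satisfying the same conditions for $f$. $f\in L^2$ iff $f,f^2$ are integrable and there is a common sequence $(f_n)_n$ such that $(f_n)_n$ is a defining sequence for $f$ and $(f_n^2)_n$ is a defining sequence for $f^2$. For $x\in X$, $\|x\|_e=\inf\{\varepsilon>0:|x|\le\varepsilon e\}$; for $f\in L^2$, $\|f\|_2=\bigl\|\int_G|f(t)|^2d\mu(t)\bigr\|_e^{1/2}$. *)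

(* Defs.v *)
From HB Require Import structures.
From mathcomp Require Import all_boot all_order all_algebra.
From mathcomp Require Import all_classical all_reals all_analysis.

Set Implicit Arguments.
Unset Strict Implicit.
Unset Printing Implicit Defensive.

Import Order.TTheory GRing.Theory Num.Theory.
Import numFieldNormedType.Exports.

Local Open Scope classical_set_scope.
Local Open Scope ring_scope.

(* Join and meet are operations characterised by their universal properties:
   a structure inheriting from both GRing.Lmodule and Order.Lattice is rejected
   by Hierarchy Builder because of its clash with Num.RealDomain. *)
HB.mixin Record isVectorLattice (R : realType) X
    of GRing.Lmodule R X & Num.POrderedZmodule X := {
  vjoin : X -> X -> X ;
  vmeet : X -> X -> X ;
  vjoin_le : forall x y z : X, (vjoin x y <= z) = (x <= z) && (y <= z) ;
  vmeet_ge : forall x y z : X, (z <= vmeet x y) = (z <= x) && (z <= y) ;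
  vl_leD2r : forall x y z : X, x <= y -> x + z <= y + z ;
  vl_scale_ge0 : forall (a : R) (x : X), 0 <= a -> 0 <= x -> 0 <= a *: x }.

#[short(type="vectorLatticeType")]
HB.structure Definition VectorLattice (R : realType) :=
  {X of GRing.Lmodule R X & Num.POrderedZmodule X & isVectorLattice R X}.

Section VectorLattices.
Context (R : realType) (X : vectorLatticeType R).

Definition vabs (x : X) : X := vjoin x (- x).

Definition dedekind_complete : Prop :=
  forall S : set X, S !=set0 -> has_ubound S -> supremums S !=set0.

Definition order_unit (e : X) : Prop :=
  forall x : X, exists2 c : R, 0 < c & vabs x <= c *: e.

Definition enorm (e x : X) : R :=
  inf [set eps : R | 0 < eps /\ vabs x <= eps *: e].

End VectorLattices.

Arguments dedekind_complete {R} X.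

Definition extremally_disconnected (Omega : topologicalType) : Prop :=
  forall U : set Omega, open U -> open (closure U).

(* T is a lattice isomorphism of X onto C(Omega), Omega compact (Hausdorff) and
   extremally disconnected, sending e to 1. By the Maeda-Ogasawara-Vulikh
   theorem there is such a T whenever X is Dedekind complete with order unit e. *)
Record MOV_isomorphism (R : realType) (X : vectorLatticeType R) (e : X)
    (Omega : topologicalType) (T : X -> Omega -> R) : Prop := {
  MOV_compact : compact [set: Omega] ;
  MOV_hausdorff : hausdorff_space Omega ;
  MOV_extremally_disconnected : extremally_disconnected Omega ;
  MOV_linear : forall (a : R) (x y : X) (w : Omega),
    T (a *: x + y) w = a * T x w + T y w ;
  MOV_join : forall (x y : X) (w : Omega),
    T (vjoin x y) w = Num.max (T x w) (T y w) ;
  MOV_meet : forall (x y : X) (w : Omega),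
    T (vmeet x y) w = Num.min (T x w) (T y w) ;
  MOV_injective : injective T ;
  MOV_range : range T = [set h : Omega -> R | continuous h] ;
  MOV_unit : forall w : Omega, T e w = 1 }.

(* The product that X inherits from C(Omega); the default 0 is never used when
   T satisfies MOV_isomorphism. *)
Definition vmul (R : realType) (X : vectorLatticeType R)
    (Omega : topologicalType) (T : X -> Omega -> R) (x y : X) : X :=
  xget 0 [set z : X | forall w : Omega, T z w = T x w * T y w].

Definition o_sequence (V : porderZmodType) (s : nat -> V) : Prop :=
  nonincreasing_seq s /\ infimums (range s) 0.

(* (o)-sequences in R^+ = ]0, +oo[ and in X^+ = {x | x >= 0, x <> 0}: in both
   cases membership is 0 < x. *)
Definition pos_o_sequence (V : porderZmodType) (s : nat -> V) : Prop :=
  o_sequence s /\ forall p, 0 < s p.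

Definition free_filter (F : set_system nat) : Prop :=
  ProperFilter F /\ forall A : set nat, finite_set (~` A) -> F A.

Section Integral.
Context (R : realType) (X : vectorLatticeType R) (e : X).
Context (F : set_system nat).
Context (d : measure_display) (G : algebraOfSetsType d).
Context (mu : {content set G -> \bar R}).

Implicit Types (f : G -> X) (fn : nat -> G -> X) (l : set G -> X).

Definition oF_lim (x : nat -> X) (y : X) : Prop :=
  exists2 s : nat -> X, o_sequence s &
    forall p, F [set n | vabs (x n - y) <= s p].

Definition simple_fun f : Prop :=
  finite_set (range f) /\ forall x : X, measurable (f @^-1` [set x]).

Definition Lstar f : Prop :=
  simple_fun f /\
  exists B : set G, [/\ measurable B, (mu B < +oo)%E
    & forall t, ~ B t -> f t = 0].

Definition indic_mul (A : set G) f : G -> X := patch (fun=> 0) A f.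

(* For f in L^* every level set of a nonzero value has finite measure, and the
   value 0 contributes 0 even if its level set has infinite measure. *)
Definition simple_integral f : X :=
  \sum_(x \in range f) fine (mu (f @^-1` [set x])) *: x.

Definition simple_integral_on (A : set G) f : X :=
  simple_integral (indic_mul A f).

Definition iota_int f : X := simple_integral (fun t => vabs (f t)).

Definition mu_converges fn f : Prop :=
  exists (eps sigma : nat -> R) (A : nat -> nat -> set G),
    [/\ pos_o_sequence eps, pos_o_sequence sigma,
        (forall n p, measurable (A n p)),
        (forall n p,
          [set t | ~ (vabs (fn n t - f t) <= eps p *: e)] `<=` A n p)
      & (forall p, F [set n | (mu (A n p) <= (sigma p)%:E)%E])].

Definition equi_absolutely_continuous fn : Prop :=
  (forall n, Lstar (fn n)) /\
  exists2 alpha : R, 0 < alpha &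
    (forall sigma : nat -> R, pos_o_sequence sigma ->
       exists (w : nat -> X) (Lambda : nat -> set nat),
         [/\ pos_o_sequence w, (forall p, F (Lambda p))
           & forall p n (B : set G), Lambda p n -> measurable B ->
               (mu B <= (sigma p)%:E)%E ->
               iota_int (indic_mul B (fun t => alpha *: fn n t)) <= w p]) /\
    (exists (r : nat -> X) (B : nat -> set G),
       [/\ pos_o_sequence r,
           (forall m, measurable (B m) /\ (mu (B m) < +oo)%E)
         & forall m, F [set n |
             iota_int (indic_mul (~` B m) (fun t => alpha *: fn n t))
               <= r m]]).

Definition unif_oF_lim fn l : Prop :=
  exists2 s : nat -> X,
    (forall n, supremums
      [set vabs (simple_integral_on A (fn n) - l A) | A in @measurable d G]
      (s n)) &
    oF_lim s 0.

Definition defining_sequence_with fn f l : Prop :=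
  [/\ equi_absolutely_continuous fn, mu_converges fn f & unif_oF_lim fn l].

Definition defining_sequence fn f : Prop :=
  exists l, defining_sequence_with fn f l.

Definition pos_integrable f : Prop :=
  (forall t, 0 <= f t) /\ exists fn, defining_sequence fn f.

(* l A for some defining sequence of f with limit l, and 0 if there is none. *)
Definition pos_integral (A : set G) f : X :=
  xget 0 [set y : X |
    exists fn l, defining_sequence_with fn f l /\ y = l A].

Definition pos_part f : G -> X := fun t => vjoin (f t) 0.
Definition neg_part f : G -> X := fun t => vjoin (- f t) 0.

Definition vintegrable f : Prop :=
  pos_integrable (pos_part f) /\ pos_integrable (neg_part f).

Definition vintegral (A : set G) f : X :=
  pos_integral A (pos_part f) - pos_integral A (neg_part f).

Context (Omega : topologicalType) (T : X -> Omega -> R).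

Definition L2 f : Prop :=
  [/\ vintegrable f, vintegrable (fun t => vmul T (f t) (f t))
    & exists fn, defining_sequence fn f /\
        defining_sequence (fun n t => vmul T (fn n t) (fn n t))
                          (fun t => vmul T (f t) (f t))].

Definition norm2 f : R :=
  Num.sqrt (enorm e
    (vintegral [set: G] (fun t => vmul T (vabs (f t)) (vabs (f t))))).

End Integral.

(* Main.v *)
Require Import Defs.
From mathcomp Require Import all_boot all_order all_algebra.
From mathcomp Require Import all_classical all_reals all_analysis.
From mathcomp Require Import ring lra.
Import Order.TTheory GRing.Theory Num.Theory.
Import numFieldNormedType.Exports.
Local Open Scope classical_set_scope.
Local Open Scope ring_scope.

(** The representation [T] turns every identity and inequality of [X] into a
    pointwise one between real functions on [Omega]; in particular the product
    of [X] becomes the product of reals.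

    The heart of the matter is a Vitali argument ([iota_sub_vanishing]): two
    equi-absolutely continuous sequences [fn], [gn] of simple functions that
    mu-converge to the same function are close in mean, i.e. the integral of
    [|fn n - gn k|] is eventually below an (o)-sequence.  Indeed one splits [G]
    into the complement of a set [C] of finite measure (uniformly small tails),
    a set [A] of small measure outside which both functions are near the limit
    (absolute continuity), and the rest of [C], where the difference is at most
    a small multiple of [e].  Taking [gn = fn] and using Dedekind completeness,
    the integrals over all measurable sets converge uniformly
    ([unif_oF_lim_exists]); taking two sequences, their limits agree
    ([limit_unique]).  So any equi-absolutely continuous, mu-convergent sequence
    is defining and may be used to compute the integral.

    For [f], [g] in L^2 with sequences [fn], [gn], the products [fn gn] are such
    a sequence for [fg]: they are dominated by [fn^2 + gn^2], which gives
    equi-absolute continuity ([uniformly_small_dominated]), and they mu-converge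
    because a mu-limit of simple functions is bounded off a set of small measure
    ([mu_convergesM]).  Any 1-Lipschitz function of [fn gn] vanishing at 0
    inherits both properties, which yields the positive and negative parts of
    [fg] and of [|fg|].

    For the inequality, [2 la |xy| <= la^2 x^2 + y^2] is integrated for simple
    functions and passed to the limit, giving [2 la c <= la^2 a + b] in [X] for
    every real [la], where [c], [a], [b] are the integrals of [|fg|], [f^2] and
    [g^2].  At each point of [Omega] the discriminant of this quadratic in [la]
    is nonpositive, that is [c^2 <= a b] ([schwarz_limit]).  The inequality
    between the norms follows by monotonicity and submultiplicativity of the
    norm defined by the order unit. *)

Set Implicit Arguments.
Unset Strict Implicit.
Unset Printing Implicit Defensive.

(** * Pointwise computation in C(Omega) *)

Section Representation.
Context (R : realType) (X : vectorLatticeType R) (e : X).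
Context (Omega : topologicalType) (T : X -> Omega -> R).
Context (hT : MOV_isomorphism e T).
Implicit Types (x y z : X) (a b : R) (w : Omega).

Lemma repr0 w : T 0 w = 0.
Proof.
have := MOV_linear hT 1 0 0 w; rewrite scaler0 addr0 mul1r => h.
by apply: (@addrI _ (T 0 w)); rewrite addr0 -h.
Qed.

Lemma reprD x y w : T (x + y) w = T x w + T y w.
Proof. by rewrite -{1}[x]scale1r (MOV_linear hT) mul1r. Qed.

Lemma reprZ a x w : T (a *: x) w = a * T x w.
Proof. by rewrite -[a *: x]addr0 (MOV_linear hT) repr0 addr0. Qed.

Lemma reprN x w : T (- x) w = - T x w.
Proof. by rewrite -scaleN1r reprZ mulN1r. Qed.

Lemma repr_abs x w : T (vabs x) w = `|T x w|.
Proof.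
rewrite (MOV_join hT) reprN; have [h|h] := leP 0 (T x w).
  by rewrite ger0_norm// max_l//; lra.
by rewrite ltr0_norm// max_r//; lra.
Qed.

(** The product of two continuous functions is continuous, hence in the range of
    [T]: the set from which [vmul] picks an element is nonempty. *)
Lemma repr_mul x y w : T (vmul T x y) w = T x w * T y w.
Proof.
have cT z : continuous (T z).
  have : range T (T z) by exists z.
  by rewrite (MOV_range hT).
have : range T (fun w => T x w * T y w).
  rewrite (MOV_range hT) /= => v; apply: continuousM; exact: cT.
case=> z _ hz; rewrite /vmul; case: xgetP => [z' -> //|/(_ z)] /=.
by rewrite hz; move=> /(_ (fun=> erefl)).
Qed.

Definition reprE := (repr0, reprD, reprZ, reprN, repr_abs, repr_mul,
  MOV_join hT, MOV_meet hT, MOV_unit hT).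

Lemma repr_inj x y : (forall w, T x w = T y w) -> x = y.
Proof. by move=> h; apply: (MOV_injective hT); apply/funext. Qed.

Lemma vjoin_eqr x y : (vjoin x y = y) <-> (x <= y).
Proof.
split => [<-|xy]; first by have := lexx (vjoin x y); rewrite vjoin_le => /andP[].
apply/eqP; rewrite eq_le vjoin_le xy lexx /=.
by have := lexx (vjoin x y); rewrite vjoin_le => /andP[].
Qed.

Lemma le_repr x y : (x <= y) <-> (forall w, T x w <= T y w).
Proof.
rewrite -vjoin_eqr; split => [h w|h].
  by rewrite -h !reprE le_max lexx.
by apply: repr_inj => w; rewrite !reprE; rewrite max_r.
Qed.

Lemma vmul_abs x : vmul T (vabs x) (vabs x) = vmul T x x.
Proof. by apply: repr_inj => w; rewrite !reprE -normrM ger0_norm ?sqr_ge0. Qed.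

Lemma subv_le0 x y : x - y <= 0 -> x <= y.
Proof.
by move=> /le_repr h; apply/le_repr => w; have := h w; rewrite !reprE subr_le0.
Qed.

End Representation.

(** * Calculus of (o)-sequences *)

Section OSequences.
Context (R : realType).

Lemma o_sequence_ge0 (V : porderZmodType) (s : nat -> V) p :
  o_sequence s -> 0 <= s p.
Proof. by case=> _ [+ _]; apply; exists p. Qed.

Lemma o_sequence_lb (V : porderZmodType) (s : nat -> V) v :
  o_sequence s -> (forall p, v <= s p) -> v <= 0.
Proof. by case=> _ [_ +] h; apply => _ [p _ <-]. Qed.

Lemma o_sequenceP (V : porderZmodType) (s : nat -> V) :
  nonincreasing_seq s -> (forall p, 0 <= s p) ->
  (forall v, (forall p, v <= s p) -> v <= 0) -> o_sequence s.
Proof.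
move=> ds s0 h; split => //; split=> [_ [p _ <-] //|v hv].
by apply: h => p; apply: hv; exists p.
Qed.

Lemma o_sequence_lt (s : nat -> R) (dl : R) :
  o_sequence s -> 0 < dl -> exists p, s p < dl.
Proof.
move=> os d0; apply: contrapT => h.
have /(o_sequence_lb os) : forall p, dl <= s p.
  by move=> p; rewrite leNgt; apply/negP => ?; apply: h; exists p.
by rewrite leNgt d0.
Qed.

Lemma o_sequence_realD (s t : nat -> R) :
  o_sequence s -> o_sequence t -> o_sequence (fun p => s p + t p).
Proof.
move=> os ot; apply: o_sequenceP.
- by move=> p q pq; apply: lerD; [apply: os.1|apply: ot.1].
- by move=> p; rewrite addr_ge0// o_sequence_ge0.
- move=> v hv; rewrite leNgt; apply/negP => v0.
  have [p hp] := o_sequence_lt os (divr_gt0 v0 (ltr0Sn _ 1)).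
  have [q hq] := o_sequence_lt ot (divr_gt0 v0 (ltr0Sn _ 1)).
  have h1 := os.1 _ _ (leq_maxl p q); have h2 := ot.1 _ _ (leq_maxr p q).
  have := hv (maxn p q); lra.
Qed.

Lemma pos_o_sequence_realD (s t : nat -> R) :
  pos_o_sequence s -> pos_o_sequence t -> pos_o_sequence (fun p => s p + t p).
Proof.
move=> [os s0] [ot t0]; split; first exact: o_sequence_realD.
by move=> p; rewrite addr_gt0.
Qed.

Lemma pos_o_sequence_harmonic : pos_o_sequence (fun p => p.+1%:R^-1 : R).
Proof.
split; last by move=> p; rewrite invr_gt0 ltr0Sn.
apply: o_sequenceP.
- by move=> p q pq; rewrite lef_pV2 ?posrE ?ltr0Sn// ler_nat ltnS.
- by move=> p; rewrite invr_ge0.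
- move=> v hv; rewrite leNgt; apply/negP => v0.
  have := hv (Num.trunc v^-1).
  have v1 : 0 < v^-1 by rewrite invr_gt0.
  have := truncnS_gt v^-1; set n := _.+1 => h.
  rewrite -[v]invrK lef_pV2 ?posrE// ?ltr0Sn//.
  by rewrite leNgt h.
Qed.

Context (X : vectorLatticeType R) (e : X).
Context (Omega : topologicalType) (T : X -> Omega -> R).
Context (hT : MOV_isomorphism e T).
Implicit Types s t : nat -> X.

(** Monotonicity decouples the indices: a lower bound of [s p + t p] is a lower
    bound of [s p + t q] for all [p] and [q], so the two infima can be taken one
    after the other. *)
Lemma o_sequenceD s t :
  o_sequence s -> o_sequence t -> o_sequence (fun p => s p + t p).
Proof.
move=> os ot; apply: o_sequenceP.
- move=> p q pq; apply/(le_repr hT) => w; rewrite !(reprE hT).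
  have /(le_repr hT)/(_ w) := os.1 _ _ pq; have /(le_repr hT)/(_ w) := ot.1 _ _ pq.
  lra.
- move=> p; apply/(le_repr hT) => w; rewrite !(reprE hT).
  have /(le_repr hT)/(_ w) := o_sequence_ge0 p os.
  have /(le_repr hT)/(_ w) := o_sequence_ge0 p ot.
  rewrite !(reprE hT); lra.
- move=> v hv; apply: (o_sequence_lb os) => p; apply: (subv_le0 hT).
  apply: (o_sequence_lb ot) => q; apply/(le_repr hT) => w; rewrite !(reprE hT).
  have /(le_repr hT)/(_ w) := os.1 _ _ (leq_maxl p q).
  have /(le_repr hT)/(_ w) := ot.1 _ _ (leq_maxr p q).
  have /(le_repr hT)/(_ w) := hv (maxn p q); rewrite !(reprE hT); lra.
Qed.

Lemma pos_o_sequenceD s t :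
  pos_o_sequence s -> pos_o_sequence t -> pos_o_sequence (fun p => s p + t p).
Proof.
move=> [os s0] [ot t0]; split; first exact: o_sequenceD.
move=> p; rewrite lt_def (o_sequence_ge0 p (o_sequenceD os ot)) andbT.
apply/eqP => h; have := s0 p; rewrite lt_neqAle => /andP[/eqP + _]; apply.
have sp := o_sequence_ge0 p os; apply/eqP; rewrite eq_le sp /= -h.
apply/(le_repr hT) => w; rewrite !(reprE hT).
have /(le_repr hT)/(_ w) := o_sequence_ge0 p ot; rewrite !(reprE hT); lra.
Qed.

Lemma o_sequenceZ (a : R) s :
  0 <= a -> o_sequence s -> o_sequence (fun p => a *: s p).
Proof.
rewrite le_eqVlt => /predU1P[<- os|a0 os].
  apply: o_sequenceP; first by move=> p q _; rewrite !scale0r.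
  - by move=> p; rewrite scale0r.
  - by move=> v /(_ 0); rewrite scale0r.
apply: o_sequenceP.
- move=> p q pq; apply/(le_repr hT) => w; rewrite !(reprE hT).
  have /(le_repr hT)/(_ w) := os.1 _ _ pq; rewrite ler_pM2l//.
- by move=> p; apply: vl_scale_ge0 (ltW a0) (o_sequence_ge0 p os).
- move=> v hv.
  have h : a^-1 *: v <= 0.
    apply: (o_sequence_lb os) => p; apply/(le_repr hT) => w.
    have /(le_repr hT)/(_ w) := hv p; rewrite !(reprE hT).
    by rewrite ler_pdivrMl.
  apply/(le_repr hT) => w; have /(le_repr hT)/(_ w) := h; rewrite !(reprE hT).
  by rewrite pmulr_rle0 ?invr_gt0.
Qed.

Lemma pos_o_sequenceZ (a : R) s :
  0 < a -> pos_o_sequence s -> pos_o_sequence (fun p => a *: s p).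
Proof.
move=> a0 [os s0]; split; first by apply: o_sequenceZ => //; exact: ltW.
move=> p; rewrite lt_neqAle eq_sym scaler_eq0 negb_or gt_eqF//=.
by rewrite gt_eqF//= vl_scale_ge0 ?ltW.
Qed.

(** The space [X] is Archimedean, being a space of real functions: real
    (o)-sequences give (o)-sequences of multiples of [e]. *)
Lemma o_sequence_scale_unit (a : R) (s : nat -> R) :
  0 <= a -> o_sequence s -> o_sequence (fun p => (s p * a) *: e).
Proof.
move=> a0 os; apply: o_sequenceP.
- move=> p q pq; apply/(le_repr hT) => w; rewrite !(reprE hT) !mulr1.
  by rewrite ler_wpM2r// os.1.
- move=> p; apply/(le_repr hT) => w; rewrite !(reprE hT) mulr1.
  by rewrite mulr_ge0// o_sequence_ge0.
- move=> v hv; apply/(le_repr hT) => w; rewrite (reprE hT).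
  rewrite leNgt; apply/negP => v0.
  have a1 : 0 < a + 1 by lra.
  have [p hp] := o_sequence_lt os (divr_gt0 v0 a1).
  have /(le_repr hT)/(_ w) := hv p; rewrite !(reprE hT) mulr1.
  move: hp; rewrite ltr_pdivlMr// => hp.
  have := o_sequence_ge0 p os; nra.
Qed.

End OSequences.

(** * Maps with finitely many measurable fibres *)

Section SimpleMaps.
Context (d : measure_display) (G : algebraOfSetsType d).

(** Simple functions with values in an arbitrary type, so that a pair of simple
    functions, whose fibres form a common refinement, is again one. *)
Definition simple_map (K : choiceType) (h : G -> K) : Prop :=
  finite_set (range h) /\ forall k, measurable (h @^-1` [set k]).

Lemma preimage_comp_fibers (K K' : choiceType) (h : G -> K) (phi : K -> K') x :
  (phi \o h) @^-1` [set x] =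
  \bigcup_(k in range h `&` phi @^-1` [set x]) h @^-1` [set k].
Proof.
apply/seteqP; split => [t /= <-|t [k [_ /= <-] /= -> //]].
by exists (h t) => //; split=> //; exists t.
Qed.

Lemma simple_map_comp (K K' : choiceType) (h : G -> K) (phi : K -> K') :
  simple_map h -> simple_map (phi \o h).
Proof.
move=> [fh mh]; split.
  by rewrite -(image_comp h phi); apply: finite_image.
move=> x; rewrite preimage_comp_fibers; apply: fin_bigcup_measurable => //.
exact: finite_setIl.
Qed.

Lemma simple_map_pair (K K' : choiceType) (h : G -> K) (h' : G -> K') :
  simple_map h -> simple_map h' -> simple_map (fun t => (h t, h' t)).
Proof.
move=> [fh mh] [fh' mh']; split.
  apply: (sub_finite_set _ (finite_setX fh fh')) => _ [t _ <-].
  by split; exists t.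
move=> [k k']; rewrite (_ : _ @^-1` _ =
    h @^-1` [set k] `&` h' @^-1` [set k']); first exact: measurableI.
by apply/seteqP; split => t /= [-> ->].
Qed.

Lemma simple_map_indicator (B : set G) : measurable B -> simple_map (fun t => t \in B).
Proof.
move=> mB; split.
  exact: finite_finset.
case.
  rewrite (_ : _ @^-1` _ = B)//; apply/seteqP; split => t /=; first exact: set_mem.
  by move=> ?; apply/mem_set.
rewrite (_ : _ @^-1` _ = ~` B); first exact: measurableC.
by apply/seteqP; split => t /=; [move/negbT; rewrite notin_setE|move=> ?; apply/negbTE; rewrite notin_setE].
Qed.

End SimpleMaps.

(** * The integral of simple functions *)

Section SimpleIntegral.
Context (R : realType) (X : vectorLatticeType R) (e : X).
Context (Omega : topologicalType) (T : X -> Omega -> R).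
Context (hT : MOV_isomorphism e T).
Context (d : measure_display) (G : algebraOfSetsType d).
Context (mu : {content set G -> \bar R}).
Implicit Types (f g : G -> X) (A B : set G).

(** The integral may be computed on any finite measurable partition finer than
    the level sets, here the fibres of [h].  Fibres of infinite measure are
    harmless where [phi] vanishes, since both sides give them the coefficient 0. *)
Lemma simple_integral_comp (K : choiceType) (h : G -> K) (phi : K -> X) :
  simple_map h -> (forall k, phi k != 0 -> (mu (h @^-1` [set k]) < +oo)%E) ->
  simple_integral mu (fun t => phi (h t)) =
  \sum_(k \in range h) fine (mu (h @^-1` [set k])) *: phi k.
Proof.
move=> sh fin; have [fh mh] := sh.
have [fphi _] := simple_map_comp phi sh.
pose u k x := if k \in phi @^-1` [set x]
  then fine (mu (h @^-1` [set k])) *: phi k else 0.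
transitivity (\sum_(x \in range (phi \o h)) \sum_(k \in range h) u k x).
  apply: eq_fsbigr => x _; rewrite -fsbig_mkcondr.
  have fI : finite_set (range h `&` phi @^-1` [set x]) by exact: finite_setIl.
  have -> : \sum_(i \in range h `&` phi @^-1` [set x])
      fine (mu (h @^-1` [set i])) *: phi i =
      (\sum_(i \in range h `&` phi @^-1` [set x])
      fine (mu (h @^-1` [set i]))) *: x.
    rewrite !fsbig_finite// scaler_suml big_seq [RHS]big_seq.
    apply: eq_bigr => k.
    by rewrite in_fset_set// inE => -[_ /= ->].
  have [->|x0] := eqVneq x 0; first by rewrite !scaler0.
  congr (_ *: _).
  rewrite -[_ @^-1` _]/((phi \o h) @^-1` [set x]) preimage_comp_fibers.
  rewrite measure_fin_bigcup//; last first.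
    by move=> i j _ _ [t [/= -> ->]].
  rewrite (eq_fsbigr (fun i => (fine (mu (h @^-1` [set i])))%:E)).
    by rewrite !fsbig_finite// sumEFin.
  move=> k; rewrite inE => -[_ /= kx]; rewrite fineK// ge0_fin_numE//.
  by apply: fin; rewrite kx.
rewrite exchange_fsbig//; apply: eq_fsbigr => k; rewrite inE => -[t _ tk].
rewrite -(fsbig_widen [set phi k]).
- by rewrite fsbig_set1 /u ifT// inE.
- by move=> _ ->; exists t => //=; rewrite tk.
- move=> x [_ xk] /=; rewrite /u ifF//; apply/negP; rewrite inE /= => ?.
  by apply: xk.
Qed.

Lemma Lstar_comp2 (phi : X -> X -> X) f g : phi 0 0 = 0 ->
  Lstar mu f -> Lstar mu g -> Lstar mu (fun t => phi (f t) (g t)).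
Proof.
move=> phi0 [sf [B [mB fB f0]]] [sg [C [mC fC g0]]]; split.
  exact: (simple_map_comp (fun p => phi p.1 p.2) (simple_map_pair sf sg)).
exists (B `|` C); split; first exact: measurableU.
  by apply: le_lt_trans (measureU2 _ mB mC) _; rewrite lte_add_pinfty.
by move=> t /not_orP[/f0 -> /g0 ->].
Qed.

Lemma Lstar_comp (phi : X -> X) f : phi 0 = 0 ->
  Lstar mu f -> Lstar mu (fun t => phi (f t)).
Proof. by move=> phi0 Lf; exact: (@Lstar_comp2 (fun x _ => phi x) f f). Qed.

Lemma LstarB f g : Lstar mu f -> Lstar mu g -> Lstar mu (fun t => f t - g t).
Proof. by move=> Lf Lg; apply: (@Lstar_comp2 (fun x y => x - y)) => //; rewrite subr0. Qed.

Lemma LstarD f g : Lstar mu f -> Lstar mu g -> Lstar mu (fun t => f t + g t).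
Proof. by move=> Lf Lg; apply: (@Lstar_comp2 +%R) => //; rewrite addr0. Qed.

Lemma LstarZ (a : R) f : Lstar mu f -> Lstar mu (fun t => a *: f t).
Proof. by apply: (@Lstar_comp (fun x => a *: x)); rewrite scaler0. Qed.

Lemma Lstar_abs f : Lstar mu f -> Lstar mu (fun t => vabs (f t)).
Proof.
by apply: (@Lstar_comp (@vabs R X)); apply: (repr_inj hT) => w; rewrite !(reprE hT) normr0.
Qed.

Lemma Lstar_indic A f : measurable A -> Lstar mu f -> Lstar mu (indic_mul A f).
Proof.
move=> mA [sf [B [mB fB f0]]]; split.
  exact: (simple_map_comp (fun p : bool * X => if p.1 then p.2 else 0)
    (simple_map_pair (simple_map_indicator mA) sf)).
by exists B; split => // t /f0 h; rewrite /indic_mul /patch h; case: ifP.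
Qed.

(** On the fibres of [(f, g)] the integrals of all functions of [f] and [g]
    that vanish with them become sums over the same index set, so that linearity of the integral is
    linearity of finite sums. *)
Lemma simple_integral_comp2 (phi : X -> X -> X) f g : phi 0 0 = 0 ->
  Lstar mu f -> Lstar mu g ->
  simple_integral mu (fun t => phi (f t) (g t)) =
  \sum_(k \in range (fun t => (f t, g t)))
    fine (mu ((fun t => (f t, g t)) @^-1` [set k])) *: phi k.1 k.2.
Proof.
move=> phi0 Lf Lg; have [sf [B [mB fB f0]]] := Lf.
have [sg [C [mC fC g0]]] := Lg; have sh := simple_map_pair sf sg.
apply: (@simple_integral_comp _ (fun t => (f t, g t))
  (fun k => phi k.1 k.2)) => //.
move=> [x y] /= xy0; apply: (@le_lt_trans _ _ (mu B + mu C)%E).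
  apply: le_trans (measureU2 _ mB mC).
  apply: le_measure; rewrite ?inE//; [exact: sh.2|exact: measurableU|].
  move=> t /= [ft gt]; apply: contrapT => /not_orP[/f0 f0t /g0 g0t].
  by move: xy0; rewrite -ft -gt f0t g0t phi0 eqxx.
by rewrite lte_add_pinfty.
Qed.

Lemma simple_integralD f g : Lstar mu f -> Lstar mu g ->
  simple_integral mu (fun t => f t + g t) =
  simple_integral mu f + simple_integral mu g.
Proof.
move=> Lf Lg; have [sf _] := Lf; have [sg _] := Lg.
have [fh _] := simple_map_pair sf sg.
rewrite (@simple_integral_comp2 +%R)//; last by rewrite addr0.
rewrite (@simple_integral_comp2 (fun x _ => x) f g)//.
rewrite (@simple_integral_comp2 (fun _ y => y) f g)//.
rewrite !fsbig_finite// -big_split; apply: eq_bigr => k _ /=.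
by rewrite scalerDr.
Qed.

Lemma simple_integralZ (a : R) f : Lstar mu f ->
  simple_integral mu (fun t => a *: f t) = a *: simple_integral mu f.
Proof.
move=> Lf; have [sf _] := Lf; have [fh _] := simple_map_pair sf sf.
rewrite (@simple_integral_comp2 (fun x _ => a *: x) f f)//; last exact: scaler0.
rewrite (@simple_integral_comp2 (fun x _ => x) f f)//.
rewrite !fsbig_finite// scaler_sumr; apply: eq_bigr => k _ /=.
by rewrite !scalerA mulrC.
Qed.

Lemma simple_integralB f g : Lstar mu f -> Lstar mu g ->
  simple_integral mu (fun t => f t - g t) =
  simple_integral mu f - simple_integral mu g.
Proof.
move=> Lf Lg; rewrite -[X in _ = _ + X]scaleN1r -simple_integralZ//.
rewrite -simple_integralD//.
  by congr simple_integral; apply/funext => t; rewrite scaleN1r.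
exact: LstarZ.
Qed.

Lemma simple_integral_ge0 f : Lstar mu f -> (forall t, 0 <= f t) ->
  0 <= simple_integral mu f.
Proof.
move=> [[ff _] _] f0; rewrite /simple_integral fsbig_finite//.
rewrite big_seq; apply: (big_ind (fun y : X => 0 <= y)) => //.
  move=> x y x0 y0; apply/(le_repr hT) => w; rewrite !(reprE hT).
  have /(le_repr hT)/(_ w) := x0; have /(le_repr hT)/(_ w) := y0.
  rewrite !(reprE hT); lra.
move=> x; rewrite in_fset_set// inE => -[t _ <-].
by apply: vl_scale_ge0 => //; rewrite fine_ge0.
Qed.

Lemma le_simple_integral f g : Lstar mu f -> Lstar mu g ->
  (forall t, f t <= g t) -> simple_integral mu f <= simple_integral mu g.
Proof.
move=> Lf Lg fg; have Lfg : Lstar mu (fun t => g t - f t).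
  exact: LstarB.
have /(le_repr hT) h : 0 <= simple_integral mu g - simple_integral mu f.
  rewrite -simple_integralB//; apply: simple_integral_ge0 => // t.
  apply/(le_repr hT) => w; have /(le_repr hT)/(_ w) := fg t.
  by rewrite !(reprE hT) subr_ge0.
by apply/(le_repr hT) => w; have := h w; rewrite !(reprE hT) subr_ge0.
Qed.

Lemma abs_simple_integral f : Lstar mu f ->
  vabs (simple_integral mu f) <= iota_int mu f.
Proof.
move=> Lf; rewrite /vabs vjoin_le; apply/andP; split.
  apply: le_simple_integral => //; first exact: Lstar_abs.
  by move=> t; apply/(le_repr hT) => w; rewrite !(reprE hT) ler_norm.
rewrite -scaleN1r -simple_integralZ//; apply: le_simple_integral.
- exact: LstarZ.
- exact: Lstar_abs.
- move=> t; apply/(le_repr hT) => w; rewrite !(reprE hT) mulN1r.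
  by rewrite -normrN ler_norm.
Qed.

Lemma Lstar_const_indic B (x : X) : measurable B -> (mu B < +oo)%E ->
  Lstar mu (indic_mul B (fun=> x)).
Proof.
move=> mB fB; split.
  exact: (simple_map_comp (fun b : bool => if b then x else 0) (simple_map_indicator mB)).
by exists B; split => // t Bt; rewrite /indic_mul /patch memNset.
Qed.

Lemma simple_integral_const_indic B (x : X) : measurable B ->
  simple_integral mu (indic_mul B (fun=> x)) = fine (mu B) *: x.
Proof.
move=> mB; set f := indic_mul B _; rewrite /simple_integral.
rewrite (fsbig_widen (range f) (range f `|` [set x])); first last.
- move=> y [[//|/= ->] nx] /=; rewrite (_ : f @^-1` _ = set0).
    by rewrite measure0 scale0r.
  by apply/seteqP; split => // t /= ft; apply: nx; exists t.
- by move=> y; left.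
rewrite -(fsbig_widen [set x]); first last.
- move=> y [[[t _ <-]|//] /=]; rewrite {1}/f /indic_mul /patch.
  by case: ifP => [_ []//|tB _]; rewrite /f /indic_mul /patch tB scaler0.
- by move=> y ->; right.
rewrite fsbig_set1; have [->|x0] := eqVneq x 0; first by rewrite !scaler0.
congr (fine (mu _) *: _); apply/seteqP; split => t /=; rewrite /f /indic_mul /patch.
  by case: ifP => [/set_mem//|_ x0']; move: x0; rewrite -x0' eqxx.
by move=> tB; rewrite mem_set.
Qed.

Lemma iotaZ (a : R) A f : 0 <= a -> measurable A -> Lstar mu f ->
  iota_int mu (indic_mul A (fun t => a *: f t)) = a *: iota_int mu (indic_mul A f).
Proof.
move=> a0 mA Lf; rewrite /iota_int -simple_integralZ; last first.
  by apply: Lstar_abs; apply: Lstar_indic.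
congr simple_integral; apply/funext => t; apply: (repr_inj hT) => w.
rewrite /indic_mul /patch; case: ifP => _; rewrite !(reprE hT).
  by rewrite normrM ger0_norm.
by rewrite normr0 mulr0.
Qed.

Lemma iota_subset A B f : measurable A -> measurable B -> A `<=` B -> Lstar mu f ->
  iota_int mu (indic_mul A f) <= iota_int mu (indic_mul B f).
Proof.
move=> mA mB AB Lf; apply: le_simple_integral.
- by apply: Lstar_abs; apply: Lstar_indic.
- by apply: Lstar_abs; apply: Lstar_indic.
- move=> t; apply/(le_repr hT) => w; rewrite /indic_mul /patch !(reprE hT).
  case: ifPn => [/set_mem/AB/mem_set ->//|_]; by rewrite (reprE hT) normr0.
Qed.

(** The splitting behind the Vitali argument: on [A] and off [B] the difference
    is bounded by [|f| + |g|], and on the rest of [B] by [c *: e]. *)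
Lemma iota_split_le f g A B (c : R) : Lstar mu f -> Lstar mu g ->
  measurable A -> measurable B -> (mu B < +oo)%E -> 0 <= c ->
  (forall t, ~ A t -> vabs (f t - g t) <= c *: e) ->
  iota_int mu (fun t => f t - g t) <=
    (iota_int mu (indic_mul (~` B) f) + iota_int mu (indic_mul (~` B) g))
    + ((c * fine (mu B)) *: e +
       (iota_int mu (indic_mul A f) + iota_int mu (indic_mul A g))).
Proof.
move=> Lf Lg mA mB fB c0 hA; have mB' := measurableC mB.
have L1 D (h : G -> X) : measurable D -> Lstar mu h -> Lstar mu (fun t => vabs (indic_mul D h t)).
  by move=> mD Lh; apply: Lstar_abs; apply: Lstar_indic.
have Lc := Lstar_const_indic (c *: e) mB fB.
rewrite mulrC -scalerA -simple_integral_const_indic// /iota_int.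
rewrite -!simple_integralD//; do ?[exact: L1 | exact: LstarD (L1 _ _ _ _) (L1 _ _ _ _)
  | exact: LstarD Lc (LstarD (L1 _ _ _ _) (L1 _ _ _ _))].
apply: le_simple_integral.
- by apply: (Lstar_abs (f := fun t => f t - g t)); apply: LstarB.
- by apply: LstarD; [apply: LstarD; exact: L1|apply: LstarD => //; apply: LstarD; exact: L1].
- move=> t; apply/(le_repr hT) => w; have := hA t.
  rewrite !(reprE hT) /indic_mul /patch in_setC.
  have nn : `|T (f t) w - T (g t) w| <= `|T (f t) w| + `|T (g t) w| by exact: ler_normB.
  have [tB|tB] := boolP (t \in B); have [tA|tA] := boolP (t \in A) => /=;
    rewrite ?(reprE hT) ?normr0 ?mulr1.
  + by move=> _; lra.
  + move=> /(_ _)/(le_repr hT)/(_ w); rewrite !(reprE hT) mulr1.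
    by rewrite notin_setE in tA; move=> /(_ tA); lra.
  + move=> _; have := normr_ge0 (T (f t) w); have := normr_ge0 (T (g t) w); lra.
  + by move=> _; lra.
Qed.

End SimpleIntegral.

(** * Order convergence along the filter, mu-convergence and equi-absolute continuity *)

Section Convergence.
Context (R : realType) (X : vectorLatticeType R) (e : X).
Context (Omega : topologicalType) (T : X -> Omega -> R).
Context (hT : MOV_isomorphism e T).
Context (F : set_system nat) (PF : ProperFilter F).
Context (d : measure_display) (G : algebraOfSetsType d).
Context (mu : {content set G -> \bar R}).
Implicit Types (f g h : G -> X) (fn gn : nat -> G -> X) (A B : set G).

(** Two indices run through the same filter set, so that Cauchy sequences and
    differences of two sequences are covered at once. *)
Definition vanishing (U : nat -> nat -> X) : Prop :=
  exists2 z : nat -> X, o_sequence z & forall q, exists2 D : set nat, F D &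
    forall n k, D n -> D k -> U n k <= z q.

(** A countable family of eventual bounds with infimum 0 suffices: its running
    meets form an (o)-sequence, and each of them is an eventual bound because
    the filter is stable under finite intersections. *)
Lemma vanishing_family (y : nat -> nat -> X) (U : nat -> nat -> X) :
  (forall i j, 0 <= y i j) ->
  (forall v, (forall i j, v <= y i j) -> v <= 0) ->
  (forall i j, exists2 D : set nat, F D &
    forall n k, D n -> D k -> U n k <= y i j) ->
  vanishing U.
Proof.
move=> y0 yinf hU.
(* an enumeration of the pairs of indices; the default pair is a harmless
   repetition *)
pose c (m : nat) : nat * nat := odflt (0, 0)%N (unpickle m).
pose y' m := y (c m).1 (c m).2.
pose z := fix z q := if q is p.+1 then vmeet (z p) (y' q) else y' 0.
have zy q : z q <= y' q.
  case: q => [|q] //=.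
  by have := lexx (vmeet (z q) (y' q.+1)); rewrite vmeet_ge => /andP[].
exists z.
  apply: o_sequenceP.
  - apply/nonincreasing_seqP => q /=.
    by have := lexx (vmeet (z q) (y' q.+1)); rewrite vmeet_ge => /andP[].
  - by elim=> [|q IH] /=; rewrite ?vmeet_ge ?IH /=; exact: y0.
  - move=> v hv; apply: yinf => i j; apply: le_trans (hv (pickle (i, j))) _.
    by apply: le_trans (zy _) _; rewrite /y' /c pickleK.
elim=> [|q [D FD hD]] /=; first exact: hU.
have [D' FD' hD'] := hU (c q.+1).1 (c q.+1).2.
exists (D `&` D'); first exact: filterI.
move=> n k [Dn D'n] [Dk D'k]; rewrite vmeet_ge hD//; exact: hD'.
Qed.

(** In the reals every (o)-sequence gets below any positive number, so the pair
    of (o)-sequences can be replaced by two tolerances chosen at will. *)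
Lemma mu_convergesP fn f : mu_converges e F mu fn f <->
  forall eps dl : R, 0 < eps -> 0 < dl -> exists A : nat -> set G,
    [/\ forall n, measurable (A n),
        forall n t, ~ A n t -> vabs (fn n t - f t) <= eps *: e
      & F [set n | (mu (A n) <= dl%:E)%E]].
Proof.
split.
  move=> [s [r [A [[os s0] [or r0] mA hA FA]]]] eps dl eps0 dl0.
  have [p hp] := o_sequence_lt os eps0; have [q hq] := o_sequence_lt or dl0.
  have ps : s (maxn p q) <= eps by apply: le_trans (os.1 _ _ (leq_maxl p q)) (ltW hp).
  have qr : r (maxn p q) <= dl by apply: le_trans (or.1 _ _ (leq_maxr p q)) (ltW hq).
  exists (A ^~ (maxn p q)); split=> //.
  - move=> n t At; have : vabs (fn n t - f t) <= s (maxn p q) *: e.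
      by apply: contrapT => /hA.
    move=> h; apply: (le_trans h); apply/(le_repr hT) => w; rewrite !(reprE hT).
    by rewrite !mulr1.
  - apply: filterS (FA (maxn p q)) => n /= h; apply: (le_trans h).
    by rewrite lee_fin.
move=> h; pose u p : R := p.+1%:R^-1.
have u0 p : 0 < u p by rewrite invr_gt0 ltr0Sn.
have /choice[A hA] : forall p, exists A : nat -> set G,
    [/\ forall n, measurable (A n),
        forall n t, ~ A n t -> vabs (fn n t - f t) <= u p *: e
      & F [set n | (mu (A n) <= (u p)%:E)%E]] by move=> p; exact: h.
exists u, u, (fun n p => A p n); split.
- exact: pos_o_sequence_harmonic.
- exact: pos_o_sequence_harmonic.
- by move=> n p; have [+ _ _] := hA p; apply.
- move=> n p t /= nle; apply: contrapT => At; apply: nle.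
  by have [_ + _] := hA p; apply.
- by move=> p; have [_ _] := hA p.
Qed.

Lemma mu_converges_contraction fn f gn g :
  (forall n t, vabs (gn n t - g t) <= vabs (fn n t - f t)) ->
  mu_converges e F mu fn f -> mu_converges e F mu gn g.
Proof.
move=> le_gf [s [r [A [os or mA hA FA]]]]; exists s, r, A; split => //.
move=> n p t /= nle; apply: hA => /= ?; apply: nle.
exact: le_trans (le_gf _ _) _.
Qed.

Lemma simple_bounded (he : order_unit e) f : finite_set (range f) ->
  exists2 C : R, 0 < C & forall t, vabs (f t) <= C *: e.
Proof.
move=> ff; have /choice[c hc] : forall x : X, exists c, 0 < c /\ vabs x <= c *: e.
  by move=> x; have [c c0 ?] := he x; exists c.
have /finite_seqP[r fr] := ff; exists (1 + \sum_(x <- r) c x).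
  by rewrite ltr_pwDl// sumr_ge0// => x _; rewrite ltW; have [] := hc x.
move=> t; have [_ h] := hc (f t); apply: (le_trans h).
have fr_t : f t \in r by have : range f (f t) by [exists t]; rewrite fr.
apply/(le_repr hT) => w; rewrite !(reprE hT) !mulr1 (big_rem (f t))//=.
have : 0 <= \sum_(x <- rem (f t) r) c x.
  by rewrite sumr_ge0// => x _; rewrite ltW; have [] := hc x.
lra.
Qed.

(** A mu-limit of simple functions is bounded by a multiple of [e] off a set of
    small measure: it is close there to one of the simple functions, which has
    finite range. *)
Lemma mu_converges_bounded (he : order_unit e) fn f (dl : R) : 0 < dl ->
  (forall n, Lstar mu (fn n)) -> mu_converges e F mu fn f ->
  exists (C : R) (A : set G), [/\ 0 < C, measurable A, (mu A <= dl%:E)%E &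
    forall t, ~ A t -> vabs (f t) <= C *: e].
Proof.
move=> dl0 Lfn /mu_convergesP/(_ 1 dl ltr01 dl0)[A [mA hA FA]].
have [n An] := filter_ex FA; have [[ff _] _] := Lfn n.
have [C C0 hC] := simple_bounded he ff.
exists (C + 1), (A n); split=> //; first by rewrite addr_gt0.
move=> t /hA/(le_repr hT) h; apply/(le_repr hT) => w.
have /(le_repr hT)/(_ w) := hC t; have := h w; rewrite !(reprE hT) !mulr1.
have -> : `|T (f t) w| = `|T (fn n t) w - (T (fn n t) w - T (f t) w)|.
  by congr `|_|; ring.
by have := ler_normB (T (fn n t) w) (T (fn n t) w - T (f t) w); lra.
Qed.

(** From [x y - u v = (x - u) (y - v) + u (y - v) + v (x - u)], where the factors
    [u] and [v], values of the limits, are bounded by [C] and [C'] off a set of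
    small measure fixed beforehand; the tolerance [eta] is then chosen according
    to these bounds. *)
Lemma mu_convergesM (he : order_unit e) fn gn f g :
  (forall n, Lstar mu (fn n)) -> (forall n, Lstar mu (gn n)) ->
  mu_converges e F mu fn f -> mu_converges e F mu gn g ->
  mu_converges e F mu (fun n t => vmul T (fn n t) (gn n t))
                      (fun t => vmul T (f t) (g t)).
Proof.
move=> Lf Lg cf cg; apply/mu_convergesP => eps dl eps0 dl0.
have dl4 : 0 < dl / 4 by lra.
have [C [A [C0 mA fA hA]]] := mu_converges_bounded he dl4 Lf cf.
have [C' [A' [C'0 mA' fA' hA']]] := mu_converges_bounded he dl4 Lg cg.
pose eta := Num.min 1 (eps / (1 + C + C')).
have D0 : 0 < 1 + C + C' by lra.
have eta0 : 0 < eta by rewrite lt_min ltr01 divr_gt0.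
have eta1 : eta <= 1 by rewrite ge_min lexx.
have eta2 : eta * (1 + C + C') <= eps.
  by rewrite -ler_pdivlMr// ge_min lexx orbT.
have /mu_convergesP/(_ _ _ eta0 dl4)[B [mB hB FB]] := cf.
have /mu_convergesP/(_ _ _ eta0 dl4)[B' [mB' hB' FB']] := cg.
exists (fun n => (A `|` A') `|` (B n `|` B' n)); split.
- by move=> n; do ?apply: measurableU.
- move=> n t /not_orP[/not_orP[/hA a /hA' a'] /not_orP[/hB b /hB' b']].
  apply/(le_repr hT) => w.
  have /(le_repr hT)/(_ w) := a; have /(le_repr hT)/(_ w) := a'.
  have /(le_repr hT)/(_ w) := b; have /(le_repr hT)/(_ w) := b'.
  rewrite !(reprE hT) !mulr1.
  move: (T (fn n t) w) (T (gn n t) w) (T (f t) w) (T (g t) w) => x y u v.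
  move=> yv xu hv hu.
  have -> : x * y - u * v = (x - u) * (y - v) + (u * (y - v) + v * (x - u)).
    by ring.
  apply: (le_trans (ler_normD _ _)).
  apply: (le_trans (lerD (lexx _) (ler_normD _ _))); rewrite !normrM.
  have h1 : `|x - u| * `|y - v| <= eta * eta by apply: ler_pM.
  have h2 : `|u| * `|y - v| <= C * eta by apply: ler_pM.
  have h3 : `|v| * `|x - u| <= C' * eta by apply: ler_pM.
  nra.
- apply: filterS2 FB FB' => n /= hb hb'.
  apply: (le_trans (measureU2 _ _ _)); do ?exact: measurableU.
  have -> : dl%:E = ((dl / 4 + dl / 4)%:E + (dl / 4 + dl / 4)%:E)%E.
    by rewrite -EFinD; congr _%:E; lra.
  by apply: leeD; rewrite EFinD; apply: (le_trans (measureU2 _ _ _)) => //; apply: leeD.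
Qed.

(** Equi-absolute continuity normalised to [alpha = 1], with the largest possible
    sets of indices. *)
Definition uniformly_small fn : Prop :=
  [/\ forall n, Lstar mu (fn n),
      forall s : nat -> R, pos_o_sequence s ->
        exists2 w : nat -> X, pos_o_sequence w & forall p, F [set n |
          forall B, measurable B -> (mu B <= (s p)%:E)%E ->
            iota_int mu (indic_mul B (fn n)) <= w p]
    & exists (r : nat -> X) (B : nat -> set G),
       [/\ pos_o_sequence r,
           forall m, measurable (B m) /\ (mu (B m) < +oo)%E
         & forall m, F [set n | iota_int mu (indic_mul (~` B m) (fn n)) <= r m]]].

(** The scalar [alpha] only multiplies the bounds by its inverse. *)
Lemma equi_acP fn : equi_absolutely_continuous F mu fn <-> uniformly_small fn.
Proof.
split.
  move=> [Lfn [a a0 [h1 [r [B [or mB FB]]]]]].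
  have a'0 : 0 < a^-1 by rewrite invr_gt0.
  have scale n (D : set G) (w : X) : measurable D ->
      iota_int mu (indic_mul D (fun t => a *: fn n t)) <= w ->
      iota_int mu (indic_mul D (fn n)) <= a^-1 *: w.
    move=> mD; rewrite (iotaZ hT (ltW a0) mD (Lfn n)) => /(le_repr hT) h.
    apply/(le_repr hT) => v; have := h v; rewrite !(reprE hT).
    by rewrite ler_pdivlMl.
  split => //.
    move=> s /h1[w [D [ow FD hD]]]; exists (fun p => a^-1 *: w p).
      exact: (pos_o_sequenceZ hT).
    move=> p; apply: filterS (FD p) => n Dn A mA sA /=; apply: scale => //.
    exact: hD sA.
  exists (fun m => a^-1 *: r m), B; split => //.
    exact: (pos_o_sequenceZ hT).
  move=> m; apply: filterS (FB m) => n /=; apply: scale.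
  by apply: measurableC; have [] := mB m.
move=> [Lfn h1 [r [B [or mB FB]]]]; split => //; exists 1 => //.
split.
  move=> s /h1[w ow hw]; exists w; eexists; split; [exact: ow|exact: hw|].
  move=> p n A /= + mA sA; rewrite (iotaZ hT)// scale1r; exact.
exists r, B; split => // m; apply: filterS (FB m) => n /=.
by rewrite (iotaZ hT)// ?scale1r//; apply: measurableC; have [] := mB m.
Qed.

Lemma iota_dominated f g h A : measurable A ->
  Lstar mu f -> Lstar mu g -> Lstar mu h ->
  (forall t, vabs (h t) <= vabs (f t) + vabs (g t)) ->
  iota_int mu (indic_mul A h) <=
    iota_int mu (indic_mul A f) + iota_int mu (indic_mul A g).
Proof.
move=> mA Lf Lg Lh hfg.
have L1 (k : G -> X) : Lstar mu k -> Lstar mu (fun t => vabs (indic_mul A k t)).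
  by move=> Lk; apply: (Lstar_abs hT); apply: Lstar_indic.
rewrite /iota_int -(simple_integralD (L1 _ Lf) (L1 _ Lg)).
apply: (le_simple_integral hT).
- exact: L1.
- by apply: LstarD; apply: L1.
- move=> t; rewrite /indic_mul /patch; case: ifP => // _.
  by apply/(le_repr hT) => w; rewrite !(reprE hT) normr0 addr0.
Qed.

(** This is how new equi-absolutely continuous sequences are obtained: products
    are dominated by squares, and Lipschitz images by the original sequence. *)
Lemma uniformly_small_dominated fn gn (hn : nat -> G -> X) :
  (forall n, Lstar mu (hn n)) ->
  (forall n t, vabs (hn n t) <= vabs (fn n t) + vabs (gn n t)) ->
  uniformly_small fn -> uniformly_small gn -> uniformly_small hn.
Proof.
move=> Lh dom [Lf f1 [r [B [or mB FB]]]] [Lg g1 [r' [B' [or' mB' FB']]]].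
have add (x y x' y' : X) : x <= x' -> y <= y' -> x + y <= x' + y'.
  move=> /(le_repr hT) h /(le_repr hT) h'; apply/(le_repr hT) => v.
  by have := h v; have := h' v; rewrite !(reprE hT); lra.
split => //.
  move=> s os; have [w ow hw] := f1 _ os; have [w' ow' hw'] := g1 _ os.
  exists (fun p => w p + w' p); first exact: (pos_o_sequenceD hT).
  move=> p; apply: filterS2 (hw p) (hw' p) => n /= hA hA' A mA sA.
  apply: le_trans (iota_dominated mA (Lf n) (Lg n) (Lh n) (dom n)) _.
  by apply: add; [exact: hA|exact: hA'].
exists (fun m => r m + r' m), (fun m => B m `|` B' m).
have mU m : measurable (B m `|` B' m).
  by apply: measurableU; [have [] := mB m|have [] := mB' m].
split; first exact: (pos_o_sequenceD hT).
  move=> m; split => //; have [m1 l1] := mB m; have [m2 l2] := mB' m.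
  by apply: le_lt_trans (measureU2 _ m1 m2) _; rewrite lte_add_pinfty.
move=> m; apply: filterS2 (FB m) (FB' m) => n /= h h'.
have mC := measurableC (mU m).
apply: le_trans (iota_dominated mC (Lf n) (Lg n) (Lh n) (dom n)) _.
have [m1 _] := mB m; have [m2 _] := mB' m.
apply: add.
  apply: le_trans h; apply: (iota_subset hT) => //; first exact: measurableC.
  by rewrite setCU => t [].
apply: le_trans h'; apply: (iota_subset hT) => //; first exact: measurableC.
by rewrite setCU => t [].
Qed.

(** The bound of [iota_split_le] is summed up in the family indexed by the set
    [C m] of finite measure and the level [p] of approximation.  For fixed [m] it
    tends to the tail bound as [p] grows, because [mu (C m)] is finite; then the
    tail bound tends to 0 as [m] grows. *)
Lemma iota_sub_vanishing fn gn h :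
  uniformly_small fn -> uniformly_small gn ->
  mu_converges e F mu fn h -> mu_converges e F mu gn h ->
  vanishing (fun n k => iota_int mu (fun t => fn n t - gn k t)).
Proof.
move=> [Lf f1 [r [B [or mB FB]]]] [Lg g1 [r' [B' [or' mB' FB']]]].
move=> [s [a [A [os oa mA hA FA]]]] [s' [a' [A' [os' oa' mA' hA' FA']]]].
have [w ow hw] := f1 _ (pos_o_sequence_realD oa oa').
have [w' ow' hw'] := g1 _ (pos_o_sequence_realD oa oa').
pose C m := B m `|` B' m.
have mC m : measurable (C m).
  by apply: measurableU; [have [] := mB m|have [] := mB' m].
have fC m : (mu (C m) < +oo)%E.
  have [m1 l1] := mB m; have [m2 l2] := mB' m.
  by apply: le_lt_trans (measureU2 _ m1 m2) _; rewrite lte_add_pinfty.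
have or2 := (pos_o_sequenceD hT or or').1.
have oy m := o_sequenceD hT
  (o_sequence_scale_unit hT (fine_ge0 (measure_ge0 mu (C m)))
     (o_sequence_realD os.1 os'.1)) (pos_o_sequenceD hT ow ow').1.
apply: (@vanishing_family (fun m p => (r m + r' m) +
  (((s p + s' p) * fine (mu (C m))) *: e + (w p + w' p)))).
- move=> m p; apply/(le_repr hT) => v.
  have /(le_repr hT)/(_ v) := o_sequence_ge0 m or2.
  have /(le_repr hT)/(_ v) := o_sequence_ge0 p (oy m).
  rewrite !(reprE hT); lra.
- move=> v hv; apply: (o_sequence_lb or2) => m; apply: (subv_le0 hT).
  apply: (o_sequence_lb (oy m)) => p; apply/(le_repr hT) => u.
  have /(le_repr hT)/(_ u) := hv m p; rewrite !(reprE hT); lra.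
- move=> m p.
  pose D1 := [set n | iota_int mu (indic_mul (~` B m) (fn n)) <= r m].
  pose D2 := [set n | iota_int mu (indic_mul (~` B' m) (gn n)) <= r' m].
  pose D3 := [set n | (mu (A n p) <= (a p)%:E)%E].
  pose D4 := [set n | (mu (A' n p) <= (a' p)%:E)%E].
  pose D5 := [set n | forall B, measurable B -> (mu B <= (a p + a' p)%:E)%E ->
            iota_int mu (indic_mul B (fn n)) <= w p].
  pose D6 := [set n | forall B, measurable B -> (mu B <= (a p + a' p)%:E)%E ->
            iota_int mu (indic_mul B (gn n)) <= w' p].
  exists ((D1 `&` D2) `&` ((D3 `&` D4) `&` (D5 `&` D6))).
    by apply: filterI; [|apply: filterI]; apply: filterI => //;
      [exact: FB|exact: FB'|exact: FA|exact: FA'|exact: hw|exact: hw'].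
  move=> n k [[d1 _] [[d3 _] [d5 _]]] [[_ d2] [[_ d4] [_ d6]]].
  have mU : measurable (A n p `|` A' k p) by apply: measurableU.
  have sU : (mu (A n p `|` A' k p) <= (a p + a' p)%:E)%E.
    by apply: (le_trans (measureU2 _ _ _)) => //; rewrite EFinD; apply: leeD.
  have s0 : 0 <= s p + s' p.
    by apply: addr_ge0; apply: o_sequence_ge0; [exact: os.1|exact: os'.1].
  apply: le_trans (iota_split_le hT (Lf n) (Lg k) mU (mC m) (fC m) s0 _) _.
    move=> t /not_orP[nA nA'].
    have /(le_repr hT) h1 : vabs (fn n t - h t) <= s p *: e.
      by apply: contrapT => /hA.
    have /(le_repr hT) h2 : vabs (gn k t - h t) <= s' p *: e.
      by apply: contrapT => /hA'.
    apply/(le_repr hT) => u; have := h1 u; have := h2 u; rewrite !(reprE hT).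
    have := ler_normB (T (fn n t) u - T (h t) u) (T (gn k t) u - T (h t) u).
    rewrite opprB addrA addrNK !mulr1; lra.
  apply/(le_repr hT) => u.
  have e1 : iota_int mu (indic_mul (~` C m) (fn n)) <= r m.
    apply: le_trans d1; apply: (iota_subset hT) => //.
    - exact: measurableC.
    - by apply: measurableC; have [] := mB m.
    - by rewrite /C setCU => t [].
  have e2 : iota_int mu (indic_mul (~` C m) (gn k)) <= r' m.
    apply: le_trans d2; apply: (iota_subset hT) => //.
    - exact: measurableC.
    - by apply: measurableC; have [] := mB' m.
    - by rewrite /C setCU => t [].
  have /(le_repr hT)/(_ u) := e1; have /(le_repr hT)/(_ u) := e2.
  have /(le_repr hT)/(_ u) := d5 _ mU sU; have /(le_repr hT)/(_ u) := d6 _ mU sU.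
  rewrite !(reprE hT); lra.
Qed.

End Convergence.

(** * Existence and uniqueness of the integral *)

Section Integral.
Context (R : realType) (X : vectorLatticeType R) (e : X).
Context (Omega : topologicalType) (T : X -> Omega -> R).
Context (hT : MOV_isomorphism e T).
Context (F : set_system nat) (PF : ProperFilter F).
Context (d : measure_display) (G : algebraOfSetsType d).
Context (mu : {content set G -> \bar R}).
Implicit Types (f g h : G -> X) (fn gn : nat -> G -> X) (A B : set G).

(** A bound that does not depend on [A] is what makes convergence in mean imply
    convergence of the integrals uniformly over [A]. *)
Lemma abs_simple_integral_on_sub f g A : measurable A ->
  Lstar mu f -> Lstar mu g ->
  vabs (simple_integral_on mu A f - simple_integral_on mu A g) <=
  iota_int mu (fun t => f t - g t).
Proof.
move=> mA Lf Lg; have Lfg := LstarB Lf Lg.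
rewrite /simple_integral_on -simple_integralB; do ?exact: Lstar_indic.
rewrite (_ : (fun t => _) = indic_mul A (fun t => f t - g t)); last first.
  by apply/funext => t; rewrite /indic_mul /patch; case: ifP; rewrite // subr0.
apply: le_trans (abs_simple_integral hT (Lstar_indic mA Lfg)) _.
apply: (le_simple_integral hT).
- by apply: (Lstar_abs hT); apply: Lstar_indic.
- exact: (Lstar_abs hT Lfg).
- move=> t; rewrite /indic_mul /patch; case: ifP => // _.
  by apply/(le_repr hT) => w; rewrite !(reprE hT) normr0.
Qed.

Lemma unif_oF_lim_bound fn (l : set G -> X) : unif_oF_lim F mu fn l ->
  exists2 z : nat -> X, o_sequence z & forall p, F [set n |
    forall A, measurable A -> vabs (simple_integral_on mu A (fn n) - l A) <= z p].
Proof.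
move=> [s hs [z oz hz]]; exists z => // p; apply: filterS (hz p) => n /=.
rewrite subr0 => /(le_repr hT) sz A mA; have [ub _] := hs n.
have /(le_repr hT) h : vabs (simple_integral_on mu A (fn n) - l A) <= s n.
  by apply: ub; exists A.
apply/(le_repr hT) => w; apply: (le_trans (h w)); apply: le_trans (sz w).
by rewrite !(reprE hT) ler_norm.
Qed.

(** The limit is the inferior limit along the filter, the supremum of the set
    [S A] of eventual lower bounds.  For [n] in the filter set belonging to [q],
    [I A n - z q] lies in [S A] and [I A n + z q] bounds [S A] from above, which
    puts [l A] within [z q] of [I A n], with the same [z] for all [A]. *)
Lemma unif_oF_lim_exists (hX : dedekind_complete X) fn f :
  uniformly_small F mu fn -> mu_converges e F mu fn f ->
  exists l, unif_oF_lim F mu fn l.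
Proof.
move=> ufn cfn; have [Lf _ _] := ufn.
have [z oz hz] := iota_sub_vanishing hT PF ufn ufn cfn cfn.
pose I A n := simple_integral_on mu A (fn n).
pose S A := [set y | exists2 D, F D & forall n, D n -> y <= I A n].
pose l A := xget 0 (supremums (S A)).
have close A q (D : set nat) n : measurable A -> F D ->
    (forall n k, D n -> D k -> iota_int mu (fun t => fn n t - fn k t) <= z q) ->
    D n -> vabs (I A n - l A) <= z q.
  move=> mA FD hD Dn.
  have IA k : D k -> vabs (I A n - I A k) <= z q.
    move=> Dk; apply: le_trans (hD _ _ Dn Dk).
    exact: abs_simple_integral_on_sub.
  have ubS : ubound (S A) (I A n + z q).
    move=> y [D' FD' hy]; have [k [Dk D'k]] := filter_ex (filterI FD FD').
    apply: le_trans (hy _ D'k) _; have /(le_repr hT) h := IA k Dk.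
    apply/(le_repr hT) => w; have := h w; rewrite !(reprE hT).
    by rewrite ler_norml => /andP[+ _]; lra.
  have inS : S A (I A n - z q).
    exists D => // k /IA/(le_repr hT) h; apply/(le_repr hT) => w.
    by have := h w; rewrite !(reprE hT) ler_norml => /andP[_]; lra.
  have [lub least] : supremums (S A) (l A).
    have [y hy] : supremums (S A) !=set0.
      by apply: hX; [exists (I A n - z q)|exists (I A n + z q)].
    by rewrite /l; case: xgetP => [y' _ //|/(_ y)].
  have /(le_repr hT) h1 := lub _ inS; have /(le_repr hT) h2 := least _ ubS.
  apply/(le_repr hT) => w; have := h1 w; have := h2 w; rewrite !(reprE hT).
  by rewrite ler_norml => *; apply/andP; split; lra.
have /choice[s hs] : forall n, exists y, supremums
    [set vabs (simple_integral_on mu A (fn n) - l A) | A in @measurable d G] y.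
  move=> n; apply: hX.
    by exists (vabs (I setT n - l setT)); exists setT.
  have [D FD hD] := hz 0%N; have [k Dk] := filter_ex FD.
  exists (iota_int mu (fun t => fn n t - fn k t) + z 0%N) => _ [A mA <-].
  have /(le_repr hT) h1 := close A _ D k mA FD hD Dk.
  have /(le_repr hT) h2 := abs_simple_integral_on_sub mA (Lf n) (Lf k).
  apply/(le_repr hT) => w; have := h1 w; have := h2 w; rewrite !(reprE hT) /I.
  have := ler_normD (T (simple_integral_on mu A (fn n)) w -
    T (simple_integral_on mu A (fn k)) w)
    (T (simple_integral_on mu A (fn k)) w - T (l A) w).
  by rewrite addrA addrNK; lra.
exists l, s => //; exists z => // q; have [D FD hD] := hz q.
apply: filterS (FD) => n Dn /=; have [ub least] := hs n.
have : s n <= z q by apply: least => _ [A mA <-]; exact: close hD Dn.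
have : 0 <= s n.
  have [/= /(_ (vabs (I setT n - l setT))) h _] := hs n.
  apply: le_trans (h _); last by exists setT.
  by apply/(le_repr hT) => w; rewrite !(reprE hT).
move=> /(le_repr hT) h0 /(le_repr hT) h1; apply/(le_repr hT) => w.
have := h0 w; have := h1 w; rewrite !(reprE hT) subr0 => ? ?.
by rewrite ger0_norm.
Qed.

Lemma defining_sequence_exists (hX : dedekind_complete X) fn f :
  uniformly_small F mu fn -> mu_converges e F mu fn f ->
  defining_sequence e F mu fn f.
Proof.
move=> ufn cfn; have [l hl] := unif_oF_lim_exists hX ufn cfn.
by exists l; split => //; apply/(equi_acP hT).
Qed.

(** The limits differ by at most the mean distance of the two sequences plus the
    two rates of convergence, for a common index in the filter. *)
Lemma limit_unique fn gn f (l l' : set G -> X) A : measurable A ->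
  defining_sequence_with e F mu fn f l -> defining_sequence_with e F mu gn f l' ->
  l A = l' A.
Proof.
move=> mA [/(equi_acP hT) ufn cfn /unif_oF_lim_bound[s os hs]].
move=> [/(equi_acP hT) ugn cgn /unif_oF_lim_bound[s' os' hs']].
have [Lf _ _] := ufn; have [Lg _ _] := ugn.
have [z oz hz] := iota_sub_vanishing hT PF ufn ugn cfn cgn.
have o3 := o_sequenceD hT oz (o_sequenceD hT os os').
have : vabs (l A - l' A) <= 0.
  apply: (o_sequence_lb o3) => p; have [D FD hD] := hz p.
  have [n [[h1 h2] Dn]] := filter_ex (filterI (filterI (hs p) (hs' p)) FD).
  have /(le_repr hT) {}h1 := h1 _ mA; have /(le_repr hT) {}h2 := h2 _ mA.
  have /(le_repr hT) h3 := hD n n Dn Dn.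
  have /(le_repr hT) h4 := abs_simple_integral_on_sub mA (Lf n) (Lg n).
  apply/(le_repr hT) => w; move: (h1 w) (h2 w) (h3 w) (h4 w); rewrite !(reprE hT).
  set x := T (simple_integral_on _ _ _) w.
  set y := T (simple_integral_on _ _ _) w.
  rewrite !ler_norml => /andP[? ?] /andP[? ?] ? /andP[? ?].
  by apply/andP; split; lra.
move=> /(le_repr hT) h; apply: (repr_inj hT) => w; have := h w.
by rewrite !(reprE hT) normr_le0 subr_eq0 => /eqP.
Qed.

Lemma pos_integralE fn f (l : set G -> X) A : measurable A ->
  defining_sequence_with e F mu fn f l -> pos_integral e F mu A f = l A.
Proof.
move=> mA hl; rewrite /pos_integral; case: xgetP => [y _|/(_ (l A))].
  by move=> [gn [l' [hl' ->]]]; apply: limit_unique mA hl' hl.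
by case; exists fn, l.
Qed.

(** The modulus, the positive and negative parts and their composites are such
    [phi].  They shrink values and differences, so that both hypotheses on [fn]
    are inherited. *)
Lemma defining_sequence_lipschitz (hX : dedekind_complete X) (phi : X -> X) fn f :
  phi 0 = 0 -> (forall x y, vabs (phi x - phi y) <= vabs (x - y)) ->
  uniformly_small F mu fn -> mu_converges e F mu fn f ->
  defining_sequence e F mu (fun n t => phi (fn n t)) (fun t => phi (f t)).
Proof.
move=> phi0 lip ufn cfn; have [Lf _ _] := ufn.
apply: (defining_sequence_exists hX); last first.
  by apply: mu_converges_contraction cfn => n t; exact: lip.
apply: (uniformly_small_dominated hT PF _ _ ufn ufn) => [n|n t].
  exact: (Lstar_comp phi0).
have /(le_repr hT) h := lip (fn n t) 0; apply/(le_repr hT) => w; have := h w.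
rewrite phi0 !(reprE hT) !subr0.
by have := normr_ge0 (T (fn n t) w); lra.
Qed.

(** The null sequence is defining for 0 as soon as some defining sequence exists,
    since the latter dominates it; in the zero space, which has no (o)-sequence
    of positive elements, nothing is integrable. *)
Lemma pos_integral0 (hX : dedekind_complete X) fn f A : measurable A ->
  defining_sequence e F mu fn f -> pos_integral e F mu A (fun=> 0) = 0.
Proof.
move=> mA [_ [/(equi_acP hT) ufn cfn _]]; have [Lf _ _] := ufn.
have [l hl] : defining_sequence e F mu (fun _ _ => 0 : X) (fun=> 0).
  apply: (@defining_sequence_lipschitz hX (fun=> 0) fn f) => // x y.
  by apply/(le_repr hT) => w; rewrite !(reprE hT) subr0 normr0.
rewrite (pos_integralE mA hl); have [_ _ /unif_oF_lim_bound[z oz hz]] := hl.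
have L0 : Lstar mu (fun=> 0 : X) by exact: (Lstar_comp (phi := fun=> 0) _ (Lf 0%N)).
have i0 : simple_integral_on mu A (fun=> 0 : X) = 0.
  rewrite /simple_integral_on -[RHS](scale0r (simple_integral mu (fun=> 0))).
  rewrite -simple_integralZ//; congr simple_integral; apply/funext => t.
  by rewrite scale0r /indic_mul /patch; case: ifP.
have : vabs (l A) <= 0.
  apply: (o_sequence_lb oz) => p; have [n /(_ _ mA)] := filter_ex (hz p).
  move=> /(le_repr hT) h; apply/(le_repr hT) => w; have := h w.
  by rewrite i0 !(reprE hT) sub0r normrN.
move=> /(le_repr hT) h; apply: (repr_inj hT) => w; have := h w.
by rewrite !(reprE hT) normr_le0 => /eqP.
Qed.

Lemma vintegral_nonneg (hX : dedekind_complete X) fn f (l : set G -> X) A :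
  (forall t, 0 <= f t) -> measurable A ->
  defining_sequence_with e F mu fn f l -> vintegral e F mu A f = l A.
Proof.
move=> f0 mA hl; rewrite /vintegral.
have -> : pos_part f = f.
  apply/funext => t; apply: (repr_inj hT) => w; rewrite !(reprE hT).
  by have /(le_repr hT)/(_ w) := f0 t; rewrite !(reprE hT) => h; rewrite max_l.
have -> : neg_part f = fun=> 0.
  apply/funext => t; apply: (repr_inj hT) => w; rewrite !(reprE hT).
  by have /(le_repr hT)/(_ w) := f0 t; rewrite !(reprE hT) => h; rewrite max_r//; lra.
rewrite (pos_integralE mA hl) (@pos_integral0 hX fn f) ?subr0//.
by exists l.
Qed.

Lemma simple_integral_onT f : simple_integral_on mu setT f = simple_integral mu f.
Proof.
congr simple_integral; apply/funext => t; rewrite /indic_mul /patch ifT//.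
by rewrite inE.
Qed.

Lemma pos_part_lipschitz (x y : X) : vabs (vjoin x 0 - vjoin y 0) <= vabs (x - y).
Proof.
apply/(le_repr hT) => w; rewrite !(reprE hT).
move: (T x w) (T y w) => a b.
have [ha|ha] := leP a 0; have [hb|hb] := leP b 0;
  rewrite ler_norml; have := ler_norm (a - b); have := ler_norm (b - a);
  rewrite distrC => *; apply/andP; split; lra.
Qed.

Lemma vintegrable_of_defining (hX : dedekind_complete X) (phi : X -> X) fn f :
  phi 0 = 0 -> (forall x y, vabs (phi x - phi y) <= vabs (x - y)) ->
  uniformly_small F mu fn -> mu_converges e F mu fn f ->
  vintegrable e F mu (fun t => phi (f t)).
Proof.
move=> phi0 lip ufn cfn.
have part (psi : X -> X) : psi 0 = 0 ->
    (forall x y, vabs (psi x - psi y) <= vabs (x - y)) ->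
    pos_integrable e F mu (fun t => vjoin (psi (f t)) 0).
  move=> psi0 lip'; split.
    move=> t; apply/(le_repr hT) => w.
    by rewrite !(reprE hT) le_max lexx orbT.
  exists (fun n t => vjoin (psi (fn n t)) 0).
  apply: (defining_sequence_lipschitz hX (phi := fun x => vjoin (psi x) 0)) => //.
    by rewrite psi0; apply/vjoin_eqr.
  by move=> x y; apply: le_trans (pos_part_lipschitz _ _) (lip' _ _).
split; first exact: part.
apply: (part (fun x => - phi x)) => [|x y]; first by rewrite phi0 oppr0.
rewrite (_ : vabs _ = vabs (phi x - phi y))//; apply: (repr_inj hT) => w.
by rewrite !(reprE hT) -normrN; congr `|_|; ring.
Qed.

Lemma vmul_ge0_sq (x : X) : 0 <= vmul T x x.
Proof. by apply/(le_repr hT) => w; rewrite !(reprE hT) -expr2 sqr_ge0. Qed.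

(** The discriminant of the nonnegative quadratic [la^2 a - 2 la c + b]. *)
Lemma sqr_le_of_quadratic (a b c : R) :
  (forall la : R, 2 * la * c <= la * la * a + b) -> c * c <= a * b.
Proof.
move=> h; pose p := Poly [:: b; - (2 * c); a].
have /deg_le2_poly_ge0 : (size p <= 3)%N by apply: size_Poly.
have h0 x : 0 <= p.[x] by rewrite horner_Poly /=; have := h x; lra.
by move=> /(_ h0); rewrite !coef_Poly /=; lra.
Qed.

End Integral.

(** * The Schwarz inequality *)

Section Schwarz.
Context (R : realType) (X : vectorLatticeType R) (e : X).
Context (Omega : topologicalType) (T : X -> Omega -> R).
Context (he : order_unit e).
Context (hT : MOV_isomorphism e T).
Context (F : set_system nat) (PF : ProperFilter F).
Context (d : measure_display) (G : algebraOfSetsType d).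
Context (mu : {content set G -> \bar R}).
Implicit Types (f g h : G -> X) (fn gn : nat -> G -> X) (A B : set G).

Lemma LstarM f g : Lstar mu f -> Lstar mu g ->
  Lstar mu (fun t => vmul T (f t) (g t)).
Proof.
apply: (Lstar_comp2 (phi := vmul T)); apply: (repr_inj hT) => w.
by rewrite !(reprE hT) mulr0.
Qed.

(** Here [|xy| <= x^2 + y^2] is used pointwise. *)
Lemma mul_uniformly_small fn gn :
  (forall n, Lstar mu (fn n)) -> (forall n, Lstar mu (gn n)) ->
  uniformly_small F mu (fun n t => vmul T (fn n t) (fn n t)) ->
  uniformly_small F mu (fun n t => vmul T (gn n t) (gn n t)) ->
  uniformly_small F mu (fun n t => vmul T (fn n t) (gn n t)).
Proof.
move=> Lf Lg; apply: (uniformly_small_dominated hT PF) => [n|n t].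
  exact: LstarM.
apply/(le_repr hT) => w; rewrite !(reprE hT).
move: (T (fn n t) w) (T (gn n t) w) => x y; rewrite !normrM.
have := sqr_ge0 (`|x| - `|y|); nra.
Qed.

(** For each real [la] the quadratic inequality holds for the integrals of the
    simple functions; the error in the limit is a combination with nonnegative
    coefficients of three (o)-sequences. *)
Lemma schwarz_limit fn gn p q r (c a b : set G -> X) :
  (forall n, Lstar mu (fn n)) -> (forall n, Lstar mu (gn n)) ->
  defining_sequence_with e F mu (fun n t => vabs (vmul T (fn n t) (gn n t))) p c ->
  defining_sequence_with e F mu (fun n t => vmul T (fn n t) (fn n t)) q a ->
  defining_sequence_with e F mu (fun n t => vmul T (gn n t) (gn n t)) r b ->
  vmul T (c setT) (c setT) <= vmul T (a setT) (b setT).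
Proof.
move=> Lf Lg [_ _ /(unif_oF_lim_bound hT PF)[s os hs]].
move=> [_ _ /(unif_oF_lim_bound hT PF)[s' os' hs']] [_ _ /(unif_oF_lim_bound hT PF)[z oz hz]].
apply/(le_repr hT) => w; rewrite !(reprE hT).
apply: sqr_le_of_quadratic => la.
have Lp n : Lstar mu (fun t => vabs (vmul T (fn n t) (gn n t))).
  by apply: (Lstar_abs hT); apply: LstarM.
have simple n : (2 * la) *: simple_integral mu (fun t => vabs (vmul T (fn n t) (gn n t)))
    <= (la * la) *: simple_integral mu (fun t => vmul T (fn n t) (fn n t))
      + simple_integral mu (fun t => vmul T (gn n t) (gn n t)).
  have Lff := LstarM (Lf n) (Lf n); have Lgg := LstarM (Lg n) (Lg n).
  rewrite -(simple_integralZ _ (Lp n)) -(simple_integralZ _ Lff).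
  rewrite -(simple_integralD (LstarZ _ Lff) Lgg).
  apply: (le_simple_integral hT); [exact: LstarZ|by apply: LstarD => //; exact: LstarZ|].
  move=> t; apply/(le_repr hT) => v; rewrite !(reprE hT) normrM.
  move: (T (fn n t) v) (T (gn n t) v) => x y.
  have sq u : u * u = `|u| * `|u| :> R.
    by rewrite -normrM ger0_norm// -expr2 sqr_ge0.
  by rewrite (sq x) (sq y); have := sqr_ge0 (la * `|x| - `|y|); lra.
have o3 := o_sequenceD hT (o_sequenceZ hT (normr_ge0 (2 * la)) os)
  (o_sequenceD hT (o_sequenceZ hT (sqr_ge0 la) os') oz).
have : (2 * la) *: c setT - ((la * la) *: a setT + b setT) <= 0.
  apply: (o_sequence_lb o3) => m.
  have [n [[h1 h2] h3]] := filter_ex (filterI (filterI (hs m) (hs' m)) (hz m)).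
  move: (h1 _ measurableT) (h2 _ measurableT) (h3 _ measurableT).
  rewrite !simple_integral_onT.
  move=> /(le_repr hT) {}h1 /(le_repr hT) {}h2 /(le_repr hT) {}h3.
  have /(le_repr hT) h4 := simple n.
  apply/(le_repr hT) => v; move: (h1 v) (h2 v) (h3 v) (h4 v); rewrite !(reprE hT).
  move: (T (simple_integral _ _) v) (T (simple_integral _ _) v) => I2 I1.
  move: (T (simple_integral _ _) v) => I3 k1 k2 k3 k4.
  have k1' : - (2 * la) * (I1 - T (c setT) v) <= `|2 * la| * T (s m) v.
    apply: le_trans (ler_wpM2l (normr_ge0 _) k1).
    by rewrite -[leRHS]normrM -[leRHS]normrN mulNr ler_norm.
  have k2' : la * la * (I2 - T (a setT) v) <= la ^+ 2 * T (s' m) v.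
    apply: le_trans (ler_wpM2l (sqr_ge0 la) k2).
    by rewrite -expr2 ler_wpM2l ?sqr_ge0// ler_norm.
  have k3' := le_trans (ler_norm _) k3.
  lra.
by move=> /(le_repr hT)/(_ w); rewrite !(reprE hT) subr_le0.
Qed.

Lemma enorm_ge0 (x : X) : 0 <= enorm e x.
Proof.
apply: lb_le_inf; last by move=> r [/ltW].
by have [c c0 hc] := he x; exists c.
Qed.

(** The infimum of the admissible factors still dominates [x], since inequalities
    are tested pointwise, where they are inequalities of reals. *)
Lemma le_enorm (x : X) : vabs x <= enorm e x *: e.
Proof.
apply/(le_repr hT) => w; rewrite !(reprE hT) mulr1.
apply: lb_le_inf; first by have [c c0 hc] := he x; exists c.
by move=> r [_ /(le_repr hT)/(_ w)]; rewrite !(reprE hT) mulr1.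
Qed.

Lemma enorm_le (x : X) (r : R) : 0 <= r -> vabs x <= r *: e -> enorm e x <= r.
Proof.
move=> r0 /(le_repr hT) xr; apply/ler_addgt0Pr => eps eps0.
apply: ge_inf; first by exists 0 => y [/ltW].
split; first by rewrite ltr_wpDl.
apply/(le_repr hT) => w; have := xr w; rewrite !(reprE hT) !mulr1; lra.
Qed.

Lemma enorm_sqr_le (x a b : X) : vmul T x x <= vmul T a b ->
  enorm e (vmul T x x) <= enorm e a * enorm e b.
Proof.
move=> /(le_repr hT) h; apply: enorm_le; first by rewrite mulr_ge0// enorm_ge0.
apply/(le_repr hT) => w; have := h w; rewrite !(reprE hT) mulr1 => {}h.
rewrite ger0_norm -?expr2 ?sqr_ge0// expr2.
apply: (le_trans h); apply: (le_trans (ler_norm _)); rewrite normrM.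
have /(le_repr hT)/(_ w) := le_enorm a; have /(le_repr hT)/(_ w) := le_enorm b.
by rewrite !(reprE hT) !mulr1 => hb ha; apply: ler_pM.
Qed.

End Schwarz.

Theorem theorem4p10
  (R : realType) (X : vectorLatticeType R) (e : X)
  (Omega : topologicalType) (T : X -> Omega -> R)
  (hX : dedekind_complete X) (he : order_unit e)
  (hT : MOV_isomorphism e T)
  (F : set_system nat) (hF : free_filter F)
  (d : measure_display) (G : algebraOfSetsType d)
  (hG : infinite_set [set: G])
  (mu : {content set G -> \bar R})
  (f g : G -> X)
  (hf : L2 e F mu T f) (hg : L2 e F mu T g) :
  let fg := fun t => vmul T (f t) (g t) in
  let abs_fg := fun t => vabs (fg t) in
  let I := vintegral e F mu [set: G] in
  [/\ vintegrable e F mu fg,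
      vintegrable e F mu abs_fg,
      vmul T (I abs_fg) (I abs_fg) <=
        vmul T (I (fun t => vmul T (f t) (f t)))
               (I (fun t => vmul T (g t) (g t)))
    & Num.sqrt (enorm e (vmul T (I abs_fg) (I abs_fg))) <=
        norm2 e F mu T f * norm2 e F mu T g].
Proof.
have PF : ProperFilter F := hF.1.
move=> fg abs_fg I.
have [_ _ [fn [[_ [/(equi_acP hT)[Lf _ _] cf _]] [a ha]]]] := hf.
have [_ _ [gn [[_ [/(equi_acP hT)[Lg _ _] cg _]] [b hb]]]] := hg.
have [/(equi_acP hT) uff _ _] := ha; have [/(equi_acP hT) ugg _ _] := hb.
have ufg := mul_uniformly_small hT PF Lf Lg uff ugg.
have cfg := mu_convergesM hT PF he Lf Lg cf cg.
have abs0 : vabs (0 : X) = 0.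
  by apply: (repr_inj hT) => w; rewrite !(reprE hT) normr0.
have abs_lip (x y : X) : vabs (vabs x - vabs y) <= vabs (x - y).
  by apply/(le_repr hT) => w; rewrite !(reprE hT) ler_dist_dist.
have [c hc] := defining_sequence_lipschitz hT PF hX abs0 abs_lip ufg cfg.
have Iff : I (fun t => vmul T (f t) (f t)) = a setT.
  by apply: (vintegral_nonneg hT PF hX _ measurableT ha) => t; exact: (vmul_ge0_sq hT).
have Igg : I (fun t => vmul T (g t) (g t)) = b setT.
  by apply: (vintegral_nonneg hT PF hX _ measurableT hb) => t; exact: (vmul_ge0_sq hT).
have Ifg : I abs_fg = c setT.
  apply: (vintegral_nonneg hT PF hX _ measurableT hc) => t.
  by apply/(le_repr hT) => w; rewrite !(reprE hT).
have ineq : vmul T (I abs_fg) (I abs_fg) <=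
    vmul T (I (fun t => vmul T (f t) (f t))) (I (fun t => vmul T (g t) (g t))).
  by rewrite Ifg Iff Igg; exact: (schwarz_limit hT PF Lf Lg hc ha hb).
have norm2E h : norm2 e F mu T h = Num.sqrt (enorm e (I (fun t => vmul T (h t) (h t)))).
  congr (Num.sqrt (enorm e (I _))); apply/funext => t; exact: (vmul_abs hT).
split => //.
- by apply: (vintegrable_of_defining hT PF hX (phi := id)) ufg cfg.
- exact: (vintegrable_of_defining hT PF hX abs0 abs_lip ufg cfg).
- rewrite !norm2E -sqrtrM ?(enorm_ge0 he)//; apply: ler_wsqrtr.
  exact: (enorm_sqr_le he hT).
Qed.
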